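(* Let $p>3$ be a prime. Then $$\sum_{k=0}^{(p-1)/2}\frac{k\binom{2k}k\binom{3k}k}{27^k}\equiv-\Big(\frac p3\Big)\frac{4-3p+2^{p+2}}{54}\pmod{p^2}.$$
   Context: $\big(\frac p3\big)$ is the Legendre symbol. Congruences are in the ring of rationals with denominators prime to $p$. *)

(* Defs.v *)
From mathcomp Require Import all_boot all_order all_algebra.

Set Implicit Arguments.
Unset Strict Implicit.
Unset Printing Implicit Defensive.

Import GRing.Theory.

Local Open Scope ring_scope.

(* Meaningful only for an odd prime q. *)
Definition legendre (a : int) (q : nat) : int :=
  if (q%:Z %| a)%Z then 0
  else if [exists x : 'I_q, ((x : nat)%:Z ^+ 2 == a %[mod q%:Z])%Z] then 1
  else -1.

(* denq is the denominator in lowest terms, so for prime p this is the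
   localization of the integers at p, viewed inside rat. *)
Definition p_integral (p : nat) (x : rat) : bool := coprimez (denq x) p%:Z.

Definition p_integral_eqmod (p : nat) (m x y : rat) : Prop :=
  [/\ p_integral p x, p_integral p y &
      exists2 z : rat, p_integral p z & x - y = m * z].

(* Main.v *)
(* Let n = (p-1)/2, m = floor(p/3) and a = m - p/3, which is -1/3 or -2/3. The
   summand is k F_k with F_k(a) = C(a,k) C(-1-a,k), and k^2 F_k telescopes, so
   the sum is a combination of F_n(a) and G(a) = sum_{k<=n} F_k(a).
   With P(a) = prod_{1<=j<=n} (1 - a^2/j^2) one has G(a) + G(a-1) = 2 P(a), hence
     G(m - p/3) = (-1)^m (G(-p/3) + 2 sum_{1<=i<=m} (-1)^i P(i - p/3)).
   Modulo p^2, the vanishing factor j = i gives P(i - p/3) = -p/(3i), while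
   F_k(-p/3) = p/(3k). As C(p,k) = (-1)^(k-1) p/k modulo p^2, both sums become
   sections of the binomial expansion of 2^p, along the multiples of 3 and of 2,
   so that G(a) = (-1)^m (2^p+1)/3. Also F_n(a) = a P(a)/(a-n) = -2p(-1)^m, and
   (-1)^m is the Legendre symbol (p/3). *)

Require Import Defs.
From HB Require Import structures.
From mathcomp Require Import all_boot all_order all_algebra.
From mathcomp Require Import ring lra zify.

Set Implicit Arguments.
Unset Strict Implicit.
Unset Printing Implicit Defensive.

Import Order.TTheory GRing.Theory Num.Theory.

Local Open Scope ring_scope.

(** * The ring of $p$-integral rationals and its congruences *)

(** By Gauss, the reduced denominator divides [b], and so it inherits coprimality to [p]. *)
Lemma p_integral_quot (p : nat) (a b : int) (x : rat) :
  coprimez b p -> x * b%:~R = a%:~R -> p_integral p x.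
Proof.
move=> cbp xb; rewrite /p_integral; apply: coprimez_dvdl cbp.
have eq_num : numq x * b = a * denq x.
  apply/eqP; rewrite -(eqr_int rat) !intrM -xb -{2}[x]divq_num_den mulrAC divfK //.
  by rewrite intr_eq0 denq_neq0.
have dvd : (denq x %| numq x * b)%Z by rewrite eq_num dvdz_mull.
move: dvd; rewrite Gauss_dvdzr // coprimez_sym.
exact: coprime_num_den.
Qed.

Lemma p_integral_subring_closed (p : nat) :
  subring_closed (p_integral p).
Proof.
have den_neq0 (x : rat) : (denq x)%:~R != 0 :> rat by rewrite intr_eq0 denq_neq0.
split=> [|x y xI yI|x y xI yI]; first by rewrite /in_mem /= /p_integral /coprimez gcd1z.
- apply: (@p_integral_quot p (numq x * denq y - numq y * denq x) (denq x * denq y)).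
    by rewrite coprimezMl; apply/andP.
  rewrite -{1}[x]divq_num_den -{1}[y]divq_num_den rmorphB !rmorphM /=.
  by field; rewrite !den_neq0.
- apply: (@p_integral_quot p (numq x * numq y) (denq x * denq y)).
    by rewrite coprimezMl; apply/andP.
  rewrite -{1}[x]divq_num_den -{1}[y]divq_num_den !rmorphM /=.
  by field; rewrite !den_neq0.
Qed.

HB.instance Definition _ (p : nat) :=
  GRing.isSubringClosed.Build rat (p_integral p) (@p_integral_subring_closed p).

Lemma p_integralV (p k : nat) : prime p -> ~~ (p %| k)%N -> k%:R^-1 \in p_integral p.
Proof.
move=> p_prime pk; have k_neq0 : k != 0%N by apply: contraNneq pk => ->.
apply: (@p_integral_quot p 1 k).
  by rewrite coprimezE coprime_sym prime_coprime.
by rewrite -pmulrn mulVf // pnatr_eq0.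
Qed.

Lemma eqmod_refl (p : nat) (m x : rat) :
  x \in p_integral p -> p_integral_eqmod p m x x.
Proof. by move=> xI; split=> //; exists 0; rewrite ?mulr0 ?subrr //; exact: rpred0. Qed.

Lemma eqmod_sym (p : nat) (m x y : rat) :
  p_integral_eqmod p m x y -> p_integral_eqmod p m y x.
Proof.
case=> xI yI [z zI xyz]; split=> //; exists (- z); first exact: rpredNr.
by rewrite mulrN -xyz opprB.
Qed.

Lemma eqmod_trans (p : nat) (m x y t : rat) :
  p_integral_eqmod p m x y -> p_integral_eqmod p m y t -> p_integral_eqmod p m x t.
Proof.
case=> xI yI [z zI xyz] [_ tI [u uI ytu]]; split=> //.
by exists (z + u); [exact: rpredD | rewrite mulrDr -xyz -ytu addrA subrK].
Qed.

Lemma eqmodD (p : nat) (m x y t u : rat) :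
  p_integral_eqmod p m x y -> p_integral_eqmod p m t u ->
  p_integral_eqmod p m (x + t) (y + u).
Proof.
case=> xI yI [z zI xyz] [tI uI [v vI tuv]]; split; try exact: rpredD.
by exists (z + v); [exact: rpredD | rewrite mulrDr -xyz -tuv; ring].
Qed.

Lemma eqmodM (p : nat) (m x y t u : rat) :
  p_integral_eqmod p m x y -> p_integral_eqmod p m t u ->
  p_integral_eqmod p m (x * t) (y * u).
Proof.
case=> xI yI [z zI xyz] [tI uI [v vI tuv]]; split; try exact: rpredM.
exists (z * t + y * v); first by apply: rpredD; exact: rpredM.
by rewrite mulrDr mulrA -xyz mulrCA -tuv; ring.
Qed.

Lemma eqmodMl (p : nat) (m c x y : rat) : c \in p_integral p ->
  p_integral_eqmod p m x y -> p_integral_eqmod p m (c * x) (c * y).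
Proof. by move=> cI; apply: eqmodM; exact: eqmod_refl. Qed.

(** With [c = m = p] this lifts a congruence modulo $p$ to one modulo $p^2$, so the cofactor of an
    explicit $p$ need only be known modulo $p$. *)
Lemma eqmodM2l (p : nat) (c m x y : rat) : c \in p_integral p ->
  p_integral_eqmod p m x y -> p_integral_eqmod p (c * m) (c * x) (c * y).
Proof.
move=> cI [xI yI [z zI xyz]]; split; try exact: rpredM.
by exists z; rewrite // -mulrBr xyz mulrA.
Qed.

Lemma eqmod_sum (p : nat) (m : rat) (I : eqType) (r : seq I) (E1 E2 : I -> rat) :
  (forall i, i \in r -> p_integral_eqmod p m (E1 i) (E2 i)) ->
  p_integral_eqmod p m (\sum_(i <- r) E1 i) (\sum_(i <- r) E2 i).
Proof.
move=> E12; rewrite 2!big_seq.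
elim/big_rec2: _ => [|i y x ri xy]; first exact/eqmod_refl/rpred0.
exact: eqmodD (E12 i ri) xy.
Qed.

Lemma eqmod_prod (p : nat) (m : rat) (I : eqType) (r : seq I) (Q : pred I)
    (E1 E2 : I -> rat) :
  (forall i, i \in r -> Q i -> p_integral_eqmod p m (E1 i) (E2 i)) ->
  p_integral_eqmod p m (\prod_(i <- r | Q i) E1 i) (\prod_(i <- r | Q i) E2 i).
Proof.
move=> E12; rewrite big_seq_cond [X in p_integral_eqmod _ _ _ X]big_seq_cond.
elim/big_rec2: _ => [|i y x /andP[ri Qi] xy]; first exact/eqmod_refl/rpred1.
exact: eqmodM (E12 i ri Qi) xy.
Qed.

(** * Exact identities for the summand, its partial sums and the sine product *)

(* This is C(a, k) C(-1 - a, k), written so that the symmetry a -> -1 - a is visible. *)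
Definition hyp (k : nat) (a : rat) : rat :=
  \prod_(0 <= j < k) (((j * j.+1)%:R - a * (a + 1)) / j.+1%:R ^+ 2).

(* The truncated Euler product of sin(pi a) / (pi a). *)
Definition sinprod (k : nat) (a : rat) : rat :=
  \prod_(1 <= j < k.+1) (1 - a ^+ 2 / j%:R ^+ 2).

Definition hypsum (n : nat) (a : rat) : rat := \sum_(0 <= k < n.+1) hyp k a.

Lemma hypS (k : nat) (a : rat) :
  hyp k.+1 a = hyp k a * (((k * k.+1)%:R - a * (a + 1)) / k.+1%:R ^+ 2).
Proof. by rewrite /hyp big_nat_recr. Qed.

Lemma sinprodS (k : nat) (a : rat) :
  sinprod k.+1 a = sinprod k a * (1 - a ^+ 2 / k.+1%:R ^+ 2).
Proof. by rewrite /sinprod big_nat_recr. Qed.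

Lemma natS_neq0 (k : nat) : (k%:R + 1 : rat) != 0.
Proof. by rewrite natr1 pnatr_eq0. Qed.

Lemma bin_bin_fact (k : nat) : ('C(2 * k, k) * 'C(3 * k, k) * k`! ^ 3 = (3 * k)`!)%N.
Proof.
have h2 := @bin_fact (2 * k) k ltac:(lia).
have h3 := @bin_fact (3 * k) k ltac:(lia).
have e2 : (2 * k - k = k)%N by lia.
have e3 : (3 * k - k = 2 * k)%N by lia.
rewrite e2 in h2; rewrite e3 -h2 in h3; rewrite -h3; lia.
Qed.

(** Consecutive terms have ratio $(3k+1)(3k+2)/(9(k+1)^2) = (k(k+1)+2/9)/(k+1)^2$, which is the
    factor of [hyp] when $a(a+1) = -2/9$. *)
Lemma bin_bin_hyp (k : nat) (a : rat) : a * (a + 1) = - (2%:R / 9%:R) ->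
  'C(2 * k, k)%:R * 'C(3 * k, k)%:R / 27%:R ^+ k = hyp k a.
Proof.
move=> a_eq; have fact_neq0 i : (i`!)%:R != 0 :> rat by rewrite pnatr_eq0 -lt0n fact_gt0.
have -> : 'C(2 * k, k)%:R * 'C(3 * k, k)%:R = (3 * k)`!%:R / k`!%:R ^+ 3 :> rat.
  by rewrite -bin_bin_fact 2!natrM natrX mulfK // expf_neq0.
elim: k => [|k IHk]; first by rewrite /hyp big_geq //= !expr0 !expr1n !divr1.
rewrite hypS -IHk a_eq (_ : 3 * k.+1 = (3 * k).+3)%N; last by lia.
rewrite !factS !natrM [27%:R ^+ _]exprS.
rewrite -(@natr1 _ (3 * k).+2) -(@natr1 _ (3 * k).+1) -(@natr1 _ (3 * k)) -(@natr1 _ k) natrM.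
have := natS_neq0 k; have := fact_neq0 k.
have : 27%:R ^+ k != 0 :> rat by rewrite expf_neq0.
by move=> h1 h2 h3; field; rewrite h1 h2 h3.
Qed.

(** Since $j(j+1)-a(a+1) = (j-a)(j+1+a)$, shifting the second factor by one index pairs $j-a$ with
    $j+a$; the ends $-a$ and $a+k+1$ remain. *)
Lemma hypSE (k : nat) (a : rat) :
  hyp k.+1 a = - a * (a + k.+1%:R) / k.+1%:R ^+ 2 * sinprod k a.
Proof.
elim: k => [|j IHj]; first by rewrite hypS /hyp /sinprod !big_geq //; field.
rewrite hypS IHj sinprodS natrM -!natr1.
have := natS_neq0 j; have := natS_neq0 j.+1; rewrite -!natr1 => h1 h2.
by field; rewrite h1 h2.
Qed.

Lemma hyp_sinprod (k : nat) (a : rat) : (a - k%:R) * hyp k a = a * sinprod k a.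
Proof.
case: k => [|k]; first by rewrite /hyp /sinprod !big_geq // subr0.
by rewrite hypSE sinprodS; have := natS_neq0 k; rewrite -!natr1 => h; field.
Qed.

(** By [hypSE] the increments at $a$ and $-a$ add up to $-2a^2/(n+1)^2$ times [sinprod n a], which
    is twice the increment of [sinprod]. *)
Lemma hypsum_add_pred (n : nat) (a : rat) :
  hypsum n a + hypsum n (a - 1) = 2%:R * sinprod n a.
Proof.
elim: n => [|n IHn].
  by rewrite /hypsum /sinprod !big_nat1 /hyp !big_geq // mulr1.
(* The symmetry $a \mapsto -1-a$ sends $a-1$ to $-a$. *)
have hyp_pred : hyp n.+1 (a - 1) = hyp n.+1 (- a).
  by apply: eq_bigr => j _; congr ((_ - _) / _); ring.
have sinprodN : sinprod n (- a) = sinprod n a.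
  by apply: eq_bigr => j _; rewrite sqrrN.
have hypsumS b : hypsum n.+1 b = hypsum n b + hyp n.+1 b by rewrite /hypsum big_nat_recr.
rewrite !hypsumS addrACA IHn hyp_pred !hypSE sinprodN sinprodS.
by have := natS_neq0 n; rewrite -!natr1 => h; field.
Qed.

Lemma hypsum_natD (n m : nat) (c : rat) :
  hypsum n (m%:R + c) =
  (-1) ^+ m * (hypsum n c + 2%:R * \sum_(1 <= i < m.+1) (-1) ^+ i * sinprod n (i%:R + c)).
Proof.
elim: m => [|m IHm]; first by rewrite big_geq // mulr0 addr0 expr0 mul1r add0r.
have h := hypsum_add_pred n (m.+1%:R + c).
have pred_m : m.+1%:R + c - 1 = m%:R + c by rewrite -natr1; ring.
move: h; rewrite pred_m IHm => /(canRL (addrK _)) ->.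
rewrite [in RHS]big_nat_recr //= exprS.
have := sqrr_sign rat m; set e := (-1) ^+ m => sq.
set s := \sum_(_ <= i < _) _; set P := sinprod n _; set G := hypsum n c.
by transitivity (2%:R * (e ^+ 2 * P) - e * (G + 2%:R * s)); [rewrite sq mul1r | ring].
Qed.

(** With $F_k$ for [hyp k a], the recurrence $(k+1)^2F_{k+1} = (k(k+1)-a(a+1))F_k$ gives
    $(k+1)^2F_{k+1} - k^2F_k = (k-a(a+1))F_k$, which telescopes. *)
Lemma sum_mul_hyp (n : nat) (a : rat) :
  \sum_(0 <= k < n.+1) k%:R * hyp k a =
  (n%:R * (n%:R + 1) - a * (a + 1)) * hyp n a + a * (a + 1) * hypsum n a.
Proof.
elim: n => [|n IHn]; first by rewrite /hypsum !big_nat1; ring.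
rewrite /hypsum [LHS]big_nat_recr //= [in RHS]big_nat_recr //= -/(hypsum _ _).
rewrite IHn hypS natrM -!natr1.
by have := natS_neq0 n => h; field.
Qed.

(** * Sine products at integers, in terms of factorials *)

Lemma sinprod_fact (k i : nat) : (k < i)%N ->
  sinprod k i%:R * (k`!%:R ^+ 2 * i%:R * (i - k.+1)`!%:R) = (-1) ^+ k * (i + k)`!%:R.
Proof.
elim: k => [|k IHk] lt_ki.
  rewrite /sinprod big_geq // subn1 addn0 fact0 expr1n !mul1r -natrM -[in RHS](prednK lt_ki) factS.
  by rewrite prednK.
have sub_eq : (i - k.+1 = (i - k.+2).+1)%N by lia.
have sub_nat : (i - k.+2).+1%:R = i%:R - k.+1%:R :> rat by rewrite -sub_eq natrB // ltnW.
have := IHk (ltnW lt_ki).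
rewrite sub_eq (factS (i - k.+2)) [(_ * (i - k.+2)`!)%:R]natrM sub_nat => h.
rewrite addnS (factS (i + k)) (factS k) sinprodS !natrM; move: h.
have h2 := natS_neq0 k; rewrite -!natr1 natrD.
set s := sinprod _ _ => h.
transitivity (- (i%:R + k%:R + 1) *
  (s * (k`!%:R ^+ 2 * i%:R * ((i%:R - (k%:R + 1)) * (i - k.+2)`!%:R)))).
  by field.
by rewrite h [(-1) ^+ k.+1]exprS; ring.
Qed.

(** Induction on [n] from [n = i], where the product stops at $i-1$ and [sinprod_fact] evaluates it;
    every later factor is $(n+1-i)(n+1+i)/(n+1)^2$. *)
Lemma sinprod_omit (n i : nat) : (0 < i <= n)%N ->
  (\prod_(1 <= j < n.+1 | j != i) (1 - i%:R ^+ 2 / j%:R ^+ 2)) * (2%:R * n`!%:R ^+ 2) =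
  (-1) ^+ i.-1 * ((n - i)`!%:R * (n + i)`!%:R) :> rat.
Proof.
case/andP=> i_gt0; elim: n => [|n IHn]; first by rewrite leqn0 => /eqP i0; rewrite i0 in i_gt0.
rewrite leq_eqVlt => /predU1P[<-{IHn}|]; last rewrite ltnS => le_in.
  case: i i_gt0 => // i _; rewrite big_mkcond big_nat_recr //= eqxx mulr1.
  rewrite big_nat (eq_bigr (fun j => 1 - i.+1%:R ^+ 2 / j%:R ^+ 2)); last first.
    by move=> j /andP[_ lt_j]; rewrite neq_ltn lt_j.
  rewrite -big_nat -/(sinprod i i.+1%:R).
  have /= := @sinprod_fact i i.+1 (leqnn _).
  rewrite subnn fact0 mulr1 factS addSn => h.
  rewrite (_ : (i.+1 + i.+1 = (i + i).+2)%N); last by lia.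
  rewrite mul1r (factS (i + i).+1) (natrM _ (i + i).+2) (natrM _ i.+1) [in RHS]mulrCA -h.
  by rewrite -!natr1 natrD; ring.
rewrite big_mkcond big_nat_recr //= -big_mkcond /= neq_ltn ltnS le_in orbT.
move: (IHn le_in); rewrite subSn // addSn !factS !natrM => h.
have h2 := natS_neq0 n; move: h; rewrite -!natr1 natrB // natrD.
set s := \prod_(_ <= _ < _ | _) _ => h.
transitivity ((n%:R - i%:R + 1) * (n%:R + i%:R + 1) * (s * (2%:R * n`!%:R ^+ 2))); first by field.
by rewrite h; ring.
Qed.

(** * The sine product and the summand near integers, modulo $p^2$ *)

Lemma eqmodDmull (p : nat) (m x z : rat) :
  m \in p_integral p -> x \in p_integral p -> z \in p_integral p ->
  p_integral_eqmod p m (x + m * z) x.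
Proof.
move=> mI xI zI; split=> //; first by apply: rpredD => //; exact: rpredM.
by exists z; rewrite // addrC addKr.
Qed.

Lemma p_integralV_lt (p k : nat) : prime p -> (0 < k < p)%N -> k%:R^-1 \in p_integral p.
Proof. by move=> p_prime /andP[k_gt0 lt_kp]; apply: p_integralV; rewrite // gtnNdvd. Qed.

(** Raising [i] by one multiplies the quotient by $(n+i+1)/(n-i)$, and $n+i+1 = p-(n-i)$, so this
    ratio is $-1$ modulo $p$. *)
Lemma fact_mul_fact_eqmod (p n i : nat) : prime p -> p = n.*2.+1 -> (i <= n)%N ->
  p_integral_eqmod p p%:R ((n - i)`!%:R * (n + i)`!%:R / n`!%:R ^+ 2) ((-1) ^+ i).
Proof.
move=> p_prime p_eq; have fact_neq0 : n`!%:R != 0 :> rat by rewrite pnatr_eq0 -lt0n fact_gt0.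
elim: i => [|i IHi] le_in.
  rewrite subn0 addn0 expr0 -expr2 divff ?expf_neq0 //.
  exact/eqmod_refl/rpred1.
have sub_eq : (n - i = (n - i.+1).+1)%N by lia.
have neq0 : (n - i)%:R != 0 :> rat by rewrite pnatr_eq0; lia.
have unit_sub : (n - i)%:R^-1 \in p_integral p by apply: p_integralV_lt; lia.
have -> : (n - i.+1)`!%:R * (n + i.+1)`!%:R / n`!%:R ^+ 2 =
    (n - i)`!%:R * (n + i)`!%:R / n`!%:R ^+ 2 * (- 1 + p%:R * (n - i)%:R^-1) :> rat.
  have p_sub : p%:R = (n + i).+1%:R + (n - i)%:R :> rat by rewrite -natrD; congr _%:R; lia.
  rewrite p_sub addnS (factS (n + i)) [in RHS]sub_eq (factS (n - i.+1)) -sub_eq.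
  rewrite !(natrM _ _.+1) natrM.
  by field; rewrite fact_neq0 neq0.
rewrite [(-1) ^+ i.+1]exprSr; apply: eqmodM; first by apply: IHi; exact: ltnW.
by apply: eqmodDmull => //; [exact: rpred_nat | exact: rpredN1].
Qed.

Lemma sinprod_omit_eqmod (p n i : nat) : prime p -> p = n.*2.+1 -> (0 < i <= n)%N ->
  p_integral_eqmod p p%:R
    (\prod_(1 <= j < n.+1 | j != i) (1 - i%:R ^+ 2 / j%:R ^+ 2)) (- 2%:R^-1).
Proof.
move=> p_prime p_eq i_bounds; have [i_gt0 le_in] := andP i_bounds.
have p_gt2 : (2 < p)%N by lia.
have fact_neq0 : n`!%:R != 0 :> rat by rewrite pnatr_eq0 -lt0n fact_gt0.
have -> : \prod_(1 <= j < n.+1 | j != i) (1 - i%:R ^+ 2 / j%:R ^+ 2) =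
    (-1) ^+ i.-1 / 2%:R * ((n - i)`!%:R * (n + i)`!%:R / n`!%:R ^+ 2) :> rat.
  apply: (@mulIf _ (2%:R * n`!%:R ^+ 2)); first by rewrite mulf_neq0 // expf_neq0.
  by rewrite (sinprod_omit i_bounds); field.
rewrite (_ : - 2%:R^-1 = (-1) ^+ i.-1 / 2%:R * (-1) ^+ i); last first.
  have -> : (-1) ^+ i = - (-1) ^+ i.-1 :> rat by rewrite -{1}(prednK i_gt0) exprS mulN1r.
  by transitivity (((-1) ^+ i.-1) ^+ 2 * - 2%:R^-1 : rat); [rewrite sqrr_sign mul1r | ring].
apply: eqmodMl; last exact: fact_mul_fact_eqmod.
by apply: rpredM; [exact: rpred_sign | exact: p_integralV_lt].
Qed.

(** The factor $j = i$ is $2p/(3i) - p^2/(9i^2)$. It supplies one $p$, so the other factors matter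
    only modulo $p$: there the shift $p/3$ disappears and their product is $-1/2$. *)
Lemma sinprod_eqmod (p n i : nat) : prime p -> (3 < p)%N -> p = n.*2.+1 -> (0 < i <= n)%N ->
  p_integral_eqmod p (p%:R ^+ 2) (sinprod n (i%:R - p%:R / 3%:R)) (- (p%:R / (3 * i)%:R)).
Proof.
move=> p_prime p_gt3 p_eq i_bounds; have [i_gt0 le_in] := andP i_bounds.
have pI : p%:R \in p_integral p by exact: rpred_nat.
have inv3 : 3%:R^-1 \in p_integral p by exact: p_integralV_lt.
have invI j : (0 < j < n.+1)%N -> j%:R^-1 \in p_integral p.
  by move=> ?; apply: p_integralV_lt; lia.
have i_neq0 : i%:R != 0 :> rat by rewrite pnatr_eq0; lia.
rewrite /sinprod (bigD1_seq i) /=; [|by rewrite mem_index_iota; lia|exact: iota_uniq].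
rewrite (_ : 1 - _ = p%:R * (2%:R * (3%:R^-1 * i%:R^-1) +
    p%:R * - (3%:R^-1 ^+ 2 * i%:R^-1 ^+ 2))); last by field.
rewrite -[X in p_integral_eqmod _ _ X]mulrA.
rewrite [X in p_integral_eqmod _ _ _ X]
  (_ : _ = p%:R * (2%:R * (3%:R^-1 * i%:R^-1) * - 2%:R^-1)); last first.
  by rewrite (natrM _ 3 i); field.
rewrite expr2; apply: eqmodM2l => //; apply: eqmodM.
  have inv_i := invI i i_bounds.
  by apply: eqmodDmull; rewrite ?rpredN ?rpredM ?rpredX ?rpred_nat.
apply: eqmod_trans (sinprod_omit_eqmod p_prime p_eq i_bounds).
apply: eqmod_prod => j; rewrite mem_index_iota => j_bounds _.
have inv_j := invI j j_bounds; have j_neq0 : j%:R != 0 :> rat by rewrite pnatr_eq0; lia.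
rewrite (_ : 1 - _ = 1 - i%:R ^+ 2 / j%:R ^+ 2 +
   p%:R * ((2%:R * i%:R * 3%:R^-1 - p%:R * 3%:R^-1 ^+ 2) * j%:R^-1 ^+ 2)); last by field.
by apply: eqmodDmull; rewrite // -?exprVn ?(rpredB, rpredM, rpredX, rpred1, rpred_nat).
Qed.

(** [hypSE] extracts the factor $p/3$; modulo $p$ each factor $1-p^2/(9j^2)$ of the remaining
    product is 1. *)
Lemma hyp_eqmod (p k : nat) : prime p -> (3 < p)%N -> (0 < k < p)%N ->
  p_integral_eqmod p (p%:R ^+ 2) (hyp k (- (p%:R / 3%:R))) (p%:R / (3 * k)%:R).
Proof.
case: k => // k p_prime p_gt3 lt_kp.
have pI : p%:R \in p_integral p by exact: rpred_nat.
have inv3 : 3%:R^-1 \in p_integral p by exact: p_integralV_lt.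
have inv_k : k.+1%:R^-1 \in p_integral p by exact: p_integralV_lt.
have k_neq0 : k.+1%:R != 0 :> rat by rewrite pnatr_eq0.
rewrite hypSE natrM; move: (k.+1%:R : rat) inv_k k_neq0 => K inv_K K_neq0.
rewrite (_ : _ * sinprod _ _ = p%:R * ((3%:R^-1 * K^-1 +
  p%:R * - (3%:R^-1 ^+ 2 * K^-1 ^+ 2)) * sinprod k (- (p%:R / 3%:R)))); last by field.
rewrite [X in p_integral_eqmod _ _ _ X](_ : _ = p%:R * (3%:R^-1 * K^-1 * 1)); last by field.
rewrite expr2; apply: eqmodM2l => //; apply: eqmodM.
  by apply: eqmodDmull; rewrite ?rpredN ?rpredM ?rpredX.
rewrite [X in p_integral_eqmod _ _ _ X](_ : 1 = \prod_(1 <= j < k.+1) 1); last first.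
  by rewrite big1_eq.
apply: eqmod_prod => j; rewrite mem_index_iota => j_bounds _.
have inv_j : j%:R^-1 \in p_integral p by apply: p_integralV_lt; lia.
have j_neq0 : j%:R != 0 :> rat by rewrite pnatr_eq0; lia.
rewrite (_ : 1 - _ = 1 + p%:R * - (p%:R * 3%:R^-1 ^+ 2 * j%:R^-1 ^+ 2)); last by field.
by apply: eqmodDmull; rewrite ?rpred1 ?rpredN ?rpredM ?rpredX.
Qed.

(** * Binomial coefficients of a prime, and sections of the binomial expansion *)

(** By Pascal's rule two neighbours add up to $\binom p{k+1}$, a multiple of $p$, so the sign
    alternates. *)
Lemma bin_prime_pred_eqmod (p k : nat) : prime p -> (k < p)%N ->
  p_integral_eqmod p p%:R 'C(p.-1, k)%:R ((-1) ^+ k).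
Proof.
move=> p_prime; elim: k => [|k IHk] lt_kp; first by rewrite bin0; exact/eqmod_refl/rpred1.
have /dvdnP[c c_eq] := prime_dvd_bin p_prime (lt_kp : 0 < k.+1 < p)%N.
have -> : 'C(p.-1, k.+1)%:R = p%:R * c%:R + -1 * 'C(p.-1, k)%:R :> rat.
  have bin_p : 'C(p, k.+1) = ('C(p.-1, k.+1) + 'C(p.-1, k))%N.
    by rewrite -binS prednK ?prime_gt0.
  by rewrite mulN1r -natrM mulnC -c_eq bin_p natrD addrK.
rewrite exprS -[X in p_integral_eqmod _ _ _ X]add0r; apply: eqmodD.
  by rewrite -[X in p_integral_eqmod _ _ X]add0r; apply: eqmodDmull; rewrite ?rpred_nat ?rpred0.
by apply: eqmodMl (IHk (ltnW lt_kp)); exact: rpredN1.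
Qed.

(** The identity $k\binom pk = p\binom{p-1}{k-1}$ provides the extra $p$. *)
Lemma bin_prime_eqmod (p k : nat) : prime p -> (0 < k < p)%N ->
  p_integral_eqmod p (p%:R ^+ 2) 'C(p, k)%:R ((-1) ^+ k.-1 * (p%:R / k%:R)).
Proof.
move=> p_prime k_bounds; have [k_gt0 lt_kp] := andP k_bounds.
have k_neq0 : k%:R != 0 :> rat by rewrite pnatr_eq0; lia.
have inv_k := p_integralV_lt p_prime k_bounds.
have -> : 'C(p, k)%:R = p%:R * (k%:R^-1 * 'C(p.-1, k.-1)%:R) :> rat.
  have diag : (k * 'C(p, k) = p * 'C(p.-1, k.-1))%N.
    by rewrite mul_bin_diag prednK.
  by apply: (mulfI k_neq0); rewrite -natrM diag natrM; field.
rewrite (_ : _ * (_ / _) = p%:R * (k%:R^-1 * (-1) ^+ k.-1)); last by field.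
rewrite expr2; apply: eqmodM2l; first exact: rpred_nat.
by apply: eqmodMl => //; apply: bin_prime_pred_eqmod => //; lia.
Qed.

Lemma sum_bin_double (n N : nat) :
  (\sum_(0 <= j < N.+1) 'C(n.+1, 2 * j) = \sum_(0 <= i < N.*2.+1) 'C(n, i))%N.
Proof.
elim: N => [|N IHN]; first by rewrite !big_nat1 !bin0.
rewrite [LHS]big_nat_recr //= IHN doubleS [RHS]big_nat_recr //= [in RHS]big_nat_recr //=.
rewrite -addnA; congr (_ + _)%N.
by rewrite (_ : 2 * N.+1 = N.*2.+2)%N ?binS 1?addnC //; lia.
Qed.

(** The bound [N] is independent of [n], so that Pascal's rule can be applied termwise; out-of-range
    binomials are 0. *)
Definition bin3 (N r n : nat) : nat := \sum_(0 <= j < N.+1) 'C(n, 3 * j + r).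

Lemma bin3S (N n : nat) : (n < 3 * N)%N ->
  [/\ bin3 N 0 n.+1 = bin3 N 0 n + bin3 N 2 n,
      bin3 N 1 n.+1 = bin3 N 1 n + bin3 N 0 n &
      bin3 N 2 n.+1 = bin3 N 2 n + bin3 N 1 n]%N.
Proof.
move=> lt_nN; have binSr r : bin3 N r.+1 n.+1 = (bin3 N r.+1 n + bin3 N r n)%N.
  by rewrite -big_split /=; apply: eq_bigr => j _; rewrite !addnS.
split=> //.
(* Residue 0 comes from residue 2 of the previous block: the index [j] shifts by one, and the
   surplus last term vanishes because $n < 3N+2$. *)
have -> : bin3 N 2 n = (\sum_(0 <= j < N) 'C(n, 3 * j + 2))%N.
  by rewrite /bin3 big_nat_recr //= (@bin_small n (3 * N + 2)) ?addn0; last by lia.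
have bin3_0l k : bin3 N 0 k = (1 + \sum_(0 <= j < N) 'C(k, 3 * j.+1 + 0))%N.
  by rewrite /bin3 big_nat_recl // bin0.
rewrite !bin3_0l -addnA -big_split /=; congr (_ + _)%N; apply: eq_bigr => j _.
by rewrite (_ : 3 * j.+1 + 0 = (3 * j + 2).+1)%N ?binS //; lia.
Qed.

(** The period 6 reflects that $1+\omega$ is a sixth root of unity for a primitive cube root of
    unity $\omega$; here six Pascal steps do the work. *)
Lemma bin3_mul6 (N k : nat) : (6 * k <= 3 * N)%N ->
  [/\ 3 * bin3 N 0 (6 * k) = 2 ^ (6 * k) + 2,
      3 * bin3 N 1 (6 * k) + 1 = 2 ^ (6 * k) &
      3 * bin3 N 2 (6 * k) + 1 = 2 ^ (6 * k)]%N.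
Proof.
elim: k => [|k IHk] le_kN.
  have bin3_0 r : bin3 N r 0 = (r == 0%N).
    rewrite /bin3 big_nat_recl // big1 ?addn0 => [|j _]; first by rewrite bin0n.
    by rewrite bin0n; lia.
  by rewrite muln0 !bin3_0.
have/IHk[h0 h1 h2] : (6 * k <= 3 * N)%N by lia.
have S0 n : (n < 3 * N)%N -> bin3 N 0 n.+1 = (bin3 N 0 n + bin3 N 2 n)%N by case/bin3S.
have S1 n : (n < 3 * N)%N -> bin3 N 1 n.+1 = (bin3 N 1 n + bin3 N 0 n)%N by case/bin3S.
have S2 n : (n < 3 * N)%N -> bin3 N 2 n.+1 = (bin3 N 2 n + bin3 N 1 n)%N by case/bin3S.
rewrite (_ : 6 * k.+1 = (6 * k).+3.+3)%N ?expnS; last by lia.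
by split; rewrite !(S0, S1, S2); lia.
Qed.

(** As $p$ is 1 or 5 modulo 6, one or five Pascal steps from a multiple of 6 suffice. *)
Lemma bin3_prime (p N : nat) : prime p -> (3 < p)%N -> (p <= 3 * N)%N ->
  (3 * bin3 N 0 p = 2 ^ p + 1)%N.
Proof.
move=> p_prime p_gt3 le_pN.
have S0 n : (n < 3 * N)%N -> bin3 N 0 n.+1 = (bin3 N 0 n + bin3 N 2 n)%N by case/bin3S.
have S1 n : (n < 3 * N)%N -> bin3 N 1 n.+1 = (bin3 N 1 n + bin3 N 0 n)%N by case/bin3S.
have S2 n : (n < 3 * N)%N -> bin3 N 2 n.+1 = (bin3 N 2 n + bin3 N 1 n)%N by case/bin3S.
have not_dvd d : (1 < d < p)%N -> ~~ (d %| p)%N.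
  case/andP=> d_gt1 lt_dp; apply: contraTN p_prime => d_p.
  by apply/negP => /primeP[_ /(_ d d_p)] /orP[]; lia.
have dvd2 := not_dvd 2%N ltac:(lia); have dvd3 := not_dvd 3%N ltac:(lia).
have [|h0 h1 h2] := @bin3_mul6 N (p %/ 6); first by lia.
have [p_eq|p_eq] : p = (6 * (p %/ 6)).+1 \/ p = (6 * (p %/ 6)).+4.+1 by lia.
  by rewrite p_eq expnS !(S0, S1, S2); lia.
by rewrite p_eq !expnS !(S0, S1, S2); lia.
Qed.

(** * The two ingredients of the sum at $a = \lfloor p/3\rfloor - p/3$, modulo $p^2$ *)

Lemma hypsum_eqmod (p : nat) : prime p -> (3 < p)%N ->
  p_integral_eqmod p (p%:R ^+ 2) (hypsum p./2 ((p %/ 3)%:R - p%:R / 3%:R))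
    ((-1) ^+ (p %/ 3) * ((2%:R ^+ p + 1) / 3%:R)).
Proof.
move=> p_prime p_gt3.
have p_odd : odd p by case: (even_prime p_prime) => // p2; rewrite p2 in p_gt3.
have p_eq : p = p./2.*2.+1 by rewrite -[LHS]odd_double_half p_odd.
set n := p./2 in p_eq *; set m := (p %/ 3)%N.
have m_le : (0 < m <= n)%N by lia.
have not_dvd3 : ~~ (3 %| p)%N.
  by rewrite dvdn_prime2 //; lia.
have inv3 : 3%:R^-1 \in p_integral p by exact: p_integralV_lt.
have two3I : 2%:R / 3%:R \in p_integral p by rewrite rpredM ?rpred_nat.
rewrite hypsum_natD; apply: eqmodMl; first exact: rpred_sign.
have sum3 : \sum_(1 <= i < m.+1) 'C(p, 3 * i)%:R = (2%:R ^+ p - 2%:R) / 3%:R :> rat.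
  (* The bound [m.+1] ensures $p \le 3N$ for [bin3_prime]; the added term is 0 since $3(m+1) >
     p$. *)
  have bin3_eq : bin3 m.+1 0 p = (1 + \sum_(1 <= i < m.+1) 'C(p, 3 * i))%N.
    rewrite /bin3 big_nat_recr //= (@bin_small p (3 * m.+1 + 0)) ?addn0; last by lia.
    by rewrite big_ltn // bin0; congr (_ + _)%N; apply: eq_bigr => i _; rewrite addn0.
  have : (3 * bin3 m.+1 0 p)%:R = (2 ^ p + 1)%:R :> rat by rewrite bin3_prime //; lia.
  by rewrite bin3_eq natrM !natrD natrX natr_sum; lra.
have sum2 : \sum_(1 <= k < n.+1) 'C(p, 2 * k)%:R = (2%:R ^+ p - 2%:R) / 2%:R :> rat.
  have : (\sum_(0 <= k < n.+1) 'C(p, 2 * k))%:R = (2 ^ n.*2)%:R :> rat.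
    rewrite [in LHS]p_eq sum_bin_double (expnDn 1 1) big_mkord.
    by congr _%:R; apply: eq_bigr => i _; rewrite !exp1n !muln1.
  have -> : 2%:R ^+ p = 2%:R * 2%:R ^+ n.*2 :> rat by rewrite {1}p_eq exprS.
  by rewrite big_ltn // bin0 natrD natrX natr_sum; lra.
(* The target is split into the term $k = 0$, the even section from [hypsum] at $-p/3$, and the
   section along multiples of 3 from the shifts. *)
have -> : (2%:R ^+ p + 1) / 3%:R =
    1 - 2%:R / 3%:R * ((2%:R ^+ p - 2%:R) / 2%:R) + 2%:R * ((2%:R ^+ p - 2%:R) / 3%:R) :> rat.
  by field.
rewrite -sum3 -sum2; apply: eqmodD.
  rewrite /hypsum big_ltn //; apply: eqmodD.
    by rewrite /hyp big_geq //; exact/eqmod_refl/rpred1.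
  rewrite -[X in p_integral_eqmod _ _ _ X]mulNr mulr_sumr.
  apply: eqmod_sum => k; rewrite mem_index_iota => k_bounds.
  apply: eqmod_trans (hyp_eqmod p_prime p_gt3 _) _; first by lia.
  (* The sign of $\binom p{2k}$ is always $-1$, hence $p/(3k)$ matches $-\frac23\binom p{2k}$. *)
  rewrite [X in p_integral_eqmod _ _ X]
    (_ : _ = - (2%:R / 3%:R) * ((-1) ^+ (2 * k).-1 * (p%:R / (2 * k)%:R))); last first.
    rewrite (_ : (2 * k).-1 = (k.-1.*2).+1)%N; last by lia.
    have : k%:R != 0 :> rat by rewrite pnatr_eq0; lia.
    by rewrite exprS -muln2 exprM sqrr_sign !natrM => ?; field.
  apply: eqmodMl; first by rewrite rpredN.
  by apply: eqmod_sym; apply: bin_prime_eqmod => //; lia.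
apply: eqmodMl; first exact: rpred_nat.
apply: eqmod_sum => i; rewrite mem_index_iota => i_bounds.
have := @sinprod_eqmod p n i p_prime p_gt3 p_eq; rewrite (_ : (0 < i <= n)%N = true); last by lia.
move=> /(_ isT) /(eqmodMl (rpred_sign _ i)) h; apply: eqmod_trans h _.
(* Here $3i-1$ and $i-1$ have the same parity, so the term matches $\binom p{3i}$. *)
rewrite (_ : _ * - _ = (-1) ^+ (3 * i).-1 * (p%:R / (3 * i)%:R)); last first.
  rewrite (_ : (3 * i).-1 = i.-1 + i.*2)%N; last by lia.
  have i_gt0 : (0 < i)%N by lia.
  have -> : (-1) ^+ i = - (-1) ^+ i.-1 :> rat by rewrite -{1}(prednK i_gt0) exprS mulN1r.
  by rewrite exprD -muln2 exprM sqrr_sign; ring.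
by apply: eqmod_sym; apply: bin_prime_eqmod => //; lia.
Qed.

Lemma divn3_parity (p : nat) : prime p -> (3 < p)%N ->
  (p %% 3 = 1 /\ ~~ odd (p %/ 3) \/ p %% 3 = 2 /\ odd (p %/ 3))%N.
Proof.
move=> p_prime p_gt3; have p_odd : odd p.
  by case: (even_prime p_prime) => // p2; rewrite p2 in p_gt3.
have : ~~ (3 %| p)%N by rewrite dvdn_prime2 //; lia.
lia.
Qed.

(** Put $r = p \bmod 3$, so $a = -r/3$. Solving [hyp_sinprod] for [hyp] and applying [sinprod_eqmod]
    at $i = m$ gives $-2rp/(k\cdot 3m)$ with $k = 3p-e$ and $3m = p-r$; modulo $p$ the denominator
    is $er$. *)
Lemma hyp_half_eqmod (p : nat) : prime p -> (3 < p)%N ->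
  p_integral_eqmod p (p%:R ^+ 2) (hyp p./2 ((p %/ 3)%:R - p%:R / 3%:R))
    (- (2%:R * p%:R * (-1) ^+ (p %/ 3))).
Proof.
move=> p_prime p_gt3.
have parity := divn3_parity p_prime p_gt3.
have p_odd : odd p by case: (even_prime p_prime) => // p2; rewrite p2 in p_gt3.
have p_eq : p = p./2.*2.+1 by rewrite -[LHS]odd_double_half p_odd.
have := hyp_sinprod p./2 ((p %/ 3)%:R - p%:R / 3%:R).
have m_bounds : (0 < p %/ 3 <= p./2)%N by lia.
have sI := sinprod_eqmod p_prime p_gt3 p_eq m_bounds.
have pR : p%:R = 3%:R * (p %/ 3)%:R + (p %% 3)%:R :> rat.
  by rewrite -natrM -natrD mulnC -divn_eq.
have nR : p./2%:R = (p%:R - 1) / 2%:R :> rat.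
  by rewrite [in RHS]p_eq -natr1 -muln2 natrM; field.
set r := (p %% 3)%N in pR parity; set m := (p %/ 3)%N in pR parity sI m_bounds *.
set h := hyp _ _; set s := sinprod _ _ in sI * => h_eq.
pose e : rat := (-1) ^+ m.
have eR : e = 3%:R - 2%:R * r%:R.
  by rewrite /e -signr_odd; case: parity => -[-> m_odd]; rewrite ?m_odd ?(negbTE m_odd).
have eK : e ^+ 2 = 1 by rewrite sqrr_sign.
(* This is $6(n-a)$ for $n = (p-1)/2$; it equals $3p-1$ or $3p+1$, hence is prime to $p$. *)
pose k := (3 * p + 2 * r - 3)%N.
have kR : k%:R = 3%:R * p%:R - e :> rat.
  by rewrite eR /k natrB ?natrD ?natrM; [ring | lia].
have k_neq0 : k%:R != 0 :> rat by rewrite pnatr_eq0; lia.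
have kV : k%:R^-1 \in p_integral p.
  apply: p_integralV => //; apply/negP => k_dvd.
  suff : (p %| 1)%N by rewrite dvdn1; lia.
  have dvd3p : (p %| 3 * p)%N by exact: dvdn_mull.
  move: k_dvd; rewrite /k; case: parity => -[-> _] k_dvd.
    by rewrite -(dvdn_addr _ k_dvd) (_ : _ + 1 = 3 * p)%N //; lia.
  by rewrite -(dvdn_addr _ dvd3p) (_ : 3 * p + 1 = 3 * p + 2 * 2 - 3)%N //; lia.
have m3_lt : (0 < 3 * m < p)%N by lia.
have m3V := p_integralV_lt p_prime m3_lt.
have m3_neq0 : (3 * m)%:R != 0 :> rat by rewrite pnatr_eq0; lia.
have m3R : (3 * m)%:R = p%:R - r%:R :> rat by rewrite natrM pR addrK.
have -> : h = 2%:R * r%:R * k%:R^-1 * s.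
  have h_k : h * k%:R = 2%:R * r%:R * s.
    have n_eq : m%:R - p%:R / 3%:R - p./2%:R = - (k%:R / 6%:R) :> rat.
      by rewrite kR eR nR pR; field.
    have a_eq : m%:R - p%:R / 3%:R = - (r%:R / 3%:R) :> rat by rewrite pR; field.
    by move: h_eq; rewrite n_eq a_eq; lra.
  by apply: (mulIf k_neq0); rewrite h_k; field.
apply: eqmod_trans.
  by apply: eqmodMl sI; rewrite !rpredM ?rpred_nat.
(* The multiple of $p^2$ comes from expanding $(3p-e)(p-r) = er + p(3p-3r-e)$ and using $e^2 =
   1$. *)
rewrite [X in p_integral_eqmod _ _ X](_ : _ = - (2%:R * p%:R * e) + p%:R ^+ 2 *
   (2%:R * e * (3%:R * p%:R - 3%:R * r%:R - e) * k%:R^-1 * (3 * m)%:R^-1)).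
  by apply: eqmodDmull; rewrite ?(rpredN, rpredM, rpredX, rpredB, rpred_sign, rpred_nat, rpred1).
rewrite -/m -/e; move: kR m3R k_neq0 m3_neq0.
move: (k%:R : rat) ((3 * m)%:R : rat) => K M KR MR K_neq0 M_neq0.
have key : 2%:R * r%:R * p%:R = 2%:R * p%:R * e * K * M -
    p%:R ^+ 2 * (2%:R * e * (3%:R * p%:R - 3%:R * r%:R - e)) :> rat.
  rewrite KR MR; transitivity (2%:R * r%:R * p%:R * e ^+ 2 : rat); last by ring.
  by rewrite eK mulr1.
apply: (mulIf K_neq0); apply: (mulIf M_neq0).
transitivity (- (2%:R * r%:R * p%:R) : rat); first by field; rewrite K_neq0 M_neq0.
by rewrite key; field; rewrite K_neq0 M_neq0.
Qed.

(** * The Legendre symbol and the final assembly *)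

Lemma legendre3 (p : nat) : prime p -> (3 < p)%N ->
  (legendre p%:Z 3)%:~R = (-1) ^+ (p %/ 3) :> rat.
Proof.
move=> p_prime p_gt3; have parity := divn3_parity p_prime p_gt3.
rewrite /legendre dvdzE /= -signr_odd.
have -> : (3 %| p)%N = false by lia.
case: parity => -[p_mod m_odd]; rewrite ?m_odd ?(negbTE m_odd).
  rewrite (_ : [exists _, _] = true) //; apply/existsP.
  by exists (Ordinal (isT : 1 < 3)%N); rewrite /= expr1n modz_nat p_mod.
rewrite (_ : [exists _, _] = false) //; apply/existsP => -[[x x_lt]].
rewrite /= (modz_nat p 3) p_mod.
by case: x x_lt => [|[|[|x]]].
Qed.

Theorem theorem3p5 (p : nat) (p_prime : prime p) (p_gt3 : (3 < p)%N) :
  p_integral_eqmod p (p%:R ^+ 2)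
    (\sum_(0 <= k < ((p - 1) %/ 2).+1)
       (k%:R * 'C(2 * k, k)%:R * 'C(3 * k, k)%:R) / 27%:R ^+ k)
    (- ((legendre p%:Z 3)%:~R
        * ((4%:R - 3%:R * p%:R + 2%:R ^+ (p + 2)) / 54%:R))).
Proof.
have parity := divn3_parity p_prime p_gt3.
have p_odd : odd p by case: (even_prime p_prime) => // p2; rewrite p2 in p_gt3.
have p_eq : p = p./2.*2.+1 by rewrite -[LHS]odd_double_half p_odd.
have nR : p./2%:R = (p%:R - 1) / 2%:R :> rat.
  by rewrite [in RHS]p_eq -natr1 -muln2 natrM; field.
have pR : p%:R = 3%:R * (p %/ 3)%:R + (p %% 3)%:R :> rat.
  by rewrite -natrM -natrD mulnC -divn_eq.
have hE := hyp_half_eqmod p_prime p_gt3; have sE := hypsum_eqmod p_prime p_gt3.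
rewrite legendre3 // (_ : (p - 1) %/ 2 = p./2)%N; last by lia.
set a := _ - _ in hE sE; set e := (-1) ^+ _ in hE sE *.
(* The values $a = -1/3$ and $a = -2/3$ are exchanged by $a \mapsto -1-a$, so both cases give the
   same product. *)
have a_eq : a * (a + 1) = - (2%:R / 9%:R).
  by rewrite /a pR; case: parity => -[-> _]; field.
rewrite (eq_bigr (fun k => k%:R * hyp k a)) => [|k _]; last first.
  by rewrite -bin_bin_hyp // !mulrA.
rewrite sum_mul_hyp a_eq.
have inv2 : 2%:R^-1 \in p_integral p by apply: p_integralV_lt; lia.
have inv3 : 3%:R^-1 \in p_integral p by exact: p_integralV_lt.
(* With $n = (p-1)/2$, $n(n+1)+2/9 = p^2/4 - 1/36$, so the coefficient of [hyp] is $-1/36$ modulo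
   $p^2$. *)
have -> : p./2%:R * (p./2%:R + 1) - - (2%:R / 9%:R) =
    - (2%:R^-1 ^+ 2 * 3%:R^-1 ^+ 2) + p%:R ^+ 2 * 2%:R^-1 ^+ 2 :> rat.
  by rewrite nR; field.
have -> : - (2%:R / 9%:R) = - (2%:R * 3%:R^-1 ^+ 2) :> rat by field.
have -> : - (e * ((4%:R - 3%:R * p%:R + 2%:R ^+ (p + 2)) / 54%:R)) =
   - (2%:R^-1 ^+ 2 * 3%:R^-1 ^+ 2) * - (2%:R * p%:R * e) +
   - (2%:R * 3%:R^-1 ^+ 2) * (e * ((2%:R ^+ p + 1) / 3%:R)).
  by rewrite exprD; field.
apply: eqmodD; last by apply: eqmodMl sE; rewrite rpredN !rpredM ?rpredX ?rpred_nat.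
apply: eqmodM hE; apply: eqmodDmull; rewrite ?rpredN ?rpredM ?rpredX ?rpred_nat //.
Qed.
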